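(* Let $G$ be a compact group and let $G_0\triangleleft G$ be an open normal subgroup. Every character of $G$ is a $\mathbb{Q}$-linear combination of characters of the form $\mathrm{Ind}_{G_1}^G\chi_1$ where $G_1$ is the preimage in $G$ of a cyclic subgroup of $G/G_0$ and $\chi_1$ is an irreducible character of $G_1$, not induced from any proper subgroup of $G_1$ containing $G_0$, whose restriction to $G_0$ is irreducible.
   Context: Characters are characters of continuous finite-dimensional complex representations. Since $G$ is compact and $G_0$ is open, $G/G_0$ is finite and induction from subgroups containing $G_0$ is the usual finite-index induction. *)

(* Defs.v *)
From HB Require Import structures.
From mathcomp Require Import all_boot all_order all_algebra.
From mathcomp Require Import all_classical all_reals all_analysis.
From mathcomp Require Import complex.

Set Implicit Arguments.
Unset Strict Implicit.
Unset Printing Implicit Defensive.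

Import Order.TTheory GRing.Theory Num.Theory.
Import numFieldNormedType.Exports.

Local Open Scope classical_set_scope.
Local Open Scope complex_scope.
Local Open Scope ring_scope.

HB.structure Definition PreTopologicalGroup := {G of Topological G & Group G}.

HB.mixin Record PreTopologicalGroup_isTopologicalGroup G
    of PreTopologicalGroup G := {
  mulg_continuous : continuous (fun xy : G * G => (xy.1 * xy.2)%g) ;
  invg_continuous : continuous (fun x : G => (x^-1)%g)
}.

(* No separation axiom is required. *)
#[short(type="topologicalGroupType")]
HB.structure Definition TopologicalGroup :=
  {G of PreTopologicalGroup G & PreTopologicalGroup_isTopologicalGroup G}.

(* Ascribing the type numClosedFieldType to R[i] lets the norm topology be
   inferred on it, and hence the product topology on matrices. *)
Definition CC (R : realType) : numClosedFieldType := R[i].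

Section Subgroups.
Context {G : groupType}.
Implicit Types H K N : set G.

Definition subgroup H : Prop := group_closed [in H].

Definition normal_subgroup N : Prop :=
  subgroup N /\ forall x g : G, N x -> N (x ^ g)%g.

Definition left_coset (x : G) H : set G := [set (x * h)%g | h in H].

Definition left_cosets H K : set (set G) := [set left_coset x H | x in K].

(* When N is normal, this is the subgroup of G/N generated by the class of x:
   the elements of G/N are the cosets of N and (xN)^k = (x^k)N for k in Z. *)
Definition quotient_cycle N (x : G) : set (set G) :=
  range (fun k : nat => left_coset (x ^+ k)%g N) `|`
  range (fun k : nat => left_coset (x ^- k)%g N).

Definition cyclic_preimage N K : Prop :=
  exists x : G, K = [set y | quotient_cycle N x (left_coset y N)].

End Subgroups.

Section Characters.
Context {R : realType} {G : topologicalGroupType}.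
Implicit Types (H K : set G) (f chi psi : G -> CC R).

(* A representation of H on C^n is given by a function on all of G of which
   only the values on H matter; the same convention holds for characters. *)
Definition representation H n (rho : G -> 'M[CC R]_n) : Prop :=
  [/\ rho 1%g = 1%:M,
      {in H &, {morph rho : x y / (x * y)%g >-> x *m y}}
    & {within H, continuous rho}].

Definition irreducible H n (rho : G -> 'M[CC R]_n) : Prop :=
  (0 < n)%N /\
  forall W : {vspace 'cV[CC R]_n},
    (forall h v, H h -> v \in W -> rho h *m v \in W) ->
    W = 0%VS \/ W = fullv.

Definition affords H n (rho : G -> 'M[CC R]_n) chi : Prop :=
  forall h, H h -> chi h = \tr (rho h).

Definition character H chi : Prop :=
  exists n (rho : G -> 'M[CC R]_n), representation H rho /\ affords H rho chi.

Definition irreducible_character H chi : Prop :=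
  exists n (rho : G -> 'M[CC R]_n),
    [/\ representation H rho, irreducible H rho & affords H rho chi].

(* Ind_H^K f (g) = sum over the cosets xH in K/H of f (x^-1 g x), where f is
   extended by 0 outside H; xget 1 X is a representative of the coset X.
   The sum is the intended one only when H has finite index in K: otherwise
   the finitely supported sum \sum_(X \in _) may take a junk value. *)
Definition Ind H K f (g : G) : CC R :=
  \sum_(X \in left_cosets H K) patch (fun=> 0) H f (g ^ xget 1%g X)%g.

Definition induced_from H K chi : Prop :=
  exists psi, character H psi /\ forall g, K g -> chi g = Ind H K psi g.

End Characters.

(* Main.v *)
Require Import Defs.
From HB Require Import structures.
From mathcomp Require Import all_boot all_order all_algebra.
From mathcomp Require Import all_classical all_reals all_analysis.

(** Since G0 is open and G compact, G/G0 is finite, and by Artin's induction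
    theorem for the trivial character (an instance of Moebius inversion over the
    preorder of cyclic subgroups) chi is a rational combination of the
    characters induced from the restrictions of chi to the preimages
    K = <x>G0 of cyclic subgroups. It remains to write a representation V of K
    as a sum of induced ones, up to trace. Let W be a simple G0-submodule of V
    and k > 0 minimal such that the twist of W by x^k is isomorphic to W, say
    through T. The map F |-> x^k F T^-1 preserves Hom_G0(W, V); the image U of an
    eigenvector is a copy of W stable under H = <x^k>G0. By minimality of k the
    translates x^i U (i < k) are pairwise non-isomorphic over G0, so their sum is
    direct and is the representation induced from U; conclude by induction on
    the quotient of V by it. A character of H = <x>G0 irreducible on G0 is not
    induced from a proper subgroup containing G0, since such an induced character
    vanishes on xG0, which Burnside's theorem forbids. *)

Set Implicit Arguments.
Unset Strict Implicit.
Unset Printing Implicit Defensive.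

Import Order.TTheory GRing.Theory Num.Theory.
Import numFieldNormedType.Exports.

Local Open Scope classical_set_scope.
Local Open Scope ring_scope.

(** * Linear algebra and simple families of matrices *)

Lemma inj_left_inverse (F : fieldType) m n (B : 'M[F]_(m, n)) :
  (forall u : 'cV_n, B *m u = 0 -> u = 0) -> exists L, L *m B = 1%:M.
Proof.
move=> Binj; have /row_freeP[L BL] : row_free B^T.
  apply: inj_row_free => v /(congr1 trmx); rewrite trmx_mul trmxK trmx0.
  by move=> /Binj /(congr1 trmx); rewrite trmxK trmx0.
by exists L^T; apply: trmx_inj; rewrite trmx_mul trmxK trmx1.
Qed.

Lemma vspace_colspace (F : fieldType) n (W : {vspace 'cV[F]_n}) :
  exists (B : 'M[F]_(n, \dim W)) (L : 'M[F]_(\dim W, n)), L *m B = 1%:M /\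
  forall v, v \in W <-> exists u, v = B *m u.
Proof.
pose B := \matrix_(i, j) (vbasis W)`_j i 0 : 'M[F]_(n, \dim W).
have BE u : B *m u = \sum_j u j 0 *: (vbasis W)`_j.
  apply/colP => i; rewrite summxE mxE; apply: eq_bigr => j _.
  by rewrite !mxE mulrC.
have [L LB] : exists L, L *m B = 1%:M.
  apply: inj_left_inverse => u; rewrite BE => u0.
  apply/colP => i; rewrite mxE.
  by have /freeP/(_ (fun j => u j 0) u0) -> := basis_free (vbasisP W).
exists B, L; split=> // v; split=> [vW|[u ->]].
  exists (\col_i coord (vbasis W) i v); rewrite BE [LHS](coord_vbasis vW).
  by apply: eq_bigr => i _; rewrite mxE.
rewrite BE memv_suml // => i _; apply: rpredZ; apply: vbasis_mem.
by rewrite mem_nth // size_tuple.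
Qed.

Lemma eq_mulmx_cV (F : fieldType) m n (A B : 'M[F]_(m, n)) :
  (forall v : 'cV_n, A *m v = B *m v) -> A = B.
Proof.
move=> AB; apply/matrixP => i j.
by have := AB (delta_mx j 0); rewrite -!colE => /colP/(_ i); rewrite !mxE.
Qed.

Lemma dim_cV (F : fieldType) n : \dim (fullv : {vspace 'cV[F]_n}) = n.
Proof. by rewrite dimvf /dim /= muln1. Qed.

Lemma ex_min_nat (P : nat -> Prop) : (exists n, P n) ->
  exists n, P n /\ forall m, P m -> (n <= m)%N.
Proof.
move=> [n Pn]; elim/ltn_ind: n Pn => n IH Pn.
have [[m [mn Pm]]|nP] := EM (exists m, (m < n)%N /\ P m); first exact: IH Pm.
by exists n; split=> // m Pm; rewrite leqNgt; apply/negP => mn; apply: nP; exists m.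
Qed.

(** The condition of [irreducible], over any field and index type: on a subgroup it is convertible
    to [irreducible], and with [rho] the identity it speaks of a set of matrices. *)
Definition simple_on (F : fieldType) (I : Type) (H : I -> Prop) n
    (rho : I -> 'M[F]_n) : Prop :=
  (0 < n)%N /\
  forall W : {vspace 'cV[F]_n},
    (forall h v, H h -> v \in W -> rho h *m v \in W) ->
    W = 0%VS \/ W = fullv.

Section Simple.
Variables (F : fieldType) (I : Type) (H : I -> Prop).

(** The kernel of [B] is stable under [sigma], hence zero as [B] is nonzero: the half of Schur's
    lemma that embeds a simple module. *)
Lemma simple_intertwiner_inj m n (sigma : I -> 'M[F]_n) (rho : I -> 'M[F]_m)
    (B : 'M[F]_(m, n)) :
  simple_on H sigma -> (forall g, H g -> rho g *m B = B *m sigma g) ->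
  B != 0 -> exists L, L *m B = 1%:M.
Proof.
move=> [n0 simp] BE Bn0; apply: inj_left_inverse => u Bu.
pose W := lker (linfun (mulmx B : 'cV_n -> 'cV_m)).
have WE v : (v \in W) = (B *m v == 0) by rewrite memv_ker lfunE.
have [|W0|WT] := simp W.
- by move=> h v Hh; rewrite !WE mulmxA -BE // -mulmxA => /eqP ->; rewrite mulmx0.
- have : u \in W by rewrite WE Bu.
  by rewrite W0 memv0 => /eqP.
case/eqP: Bn0; apply: eq_mulmx_cV => v; rewrite mul0mx; apply/eqP.
by rewrite -WE WT memvf.
Qed.

(** A nonzero stable subspace of least dimension is simple; the columns of [B] are a basis of it. *)
Lemma simple_submodule n (rho : I -> 'M[F]_n) : (0 < n)%N ->
  exists d (B : 'M[F]_(n, d)) L, [/\ L *m B = 1%:M,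
    (forall g, H g -> rho g *m B = B *m (L *m rho g *m B)) &
    simple_on H (fun g => L *m rho g *m B)].
Proof.
move=> n0.
pose P d := exists W : {vspace 'cV[F]_n}, [/\ \dim W = d, W != 0%VS &
  forall h v, H h -> v \in W -> rho h *m v \in W].
have [d [[W [Wd W0 Wst]] dmin]] : exists d, P d /\ forall e, P e -> (d <= e)%N.
  apply: ex_min_nat; exists n, fullv; split=> [||*]; rewrite ?memvf //.
    exact: dim_cV.
  by rewrite -dimv_eq0 dim_cV -lt0n.
have [B [L [LB WE]]] := vspace_colspace W.
have BL v : v \in W -> B *m (L *m v) = v.
  by move=> /WE[u ->]; rewrite (mulmxA L) LB mul1mx.
have BE g : H g -> rho g *m B = B *m (L *m rho g *m B).
  move=> Hg; apply: eq_mulmx_cV => u; rewrite -!mulmxA BL //.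
  by apply: Wst => //; apply/WE; exists u.
exists (\dim W), B, L; split=> //; split; first by rewrite lt0n dimv_eq0.
move=> U Ust.
pose f : 'Hom('cV[F]_(\dim W), 'cV[F]_n) := linfun (mulmx B).
have finj : lker f == 0%VS.
  apply/lker0P => u v; rewrite !lfunE /= => /(congr1 (mulmx L)).
  by rewrite !mulmxA LB !mul1mx.
have dfU : \dim (f @: U)%VS = \dim U by rewrite limg_dim_eq // (eqP finj) capv0.
have [->|Un0] := eqVneq U 0%VS; [by left|right].
apply/eqP; rewrite eqEdim subvf dim_cV -dfU /=.
apply: (@leq_trans d); first by rewrite Wd.
apply: dmin; exists (f @: U)%VS; split=> //.
  by rewrite -dimv_eq0 dfU dimv_eq0.
move=> h w Hh /memv_imgP[u uU ->]; apply/memv_imgP.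
exists (L *m rho h *m B *m u); first exact: Ust.
by rewrite !lfunE /= mulmxA BE // [RHS]mulmxA.
Qed.

End Simple.

Lemma simple_nonzero (F : fieldType) (I : Type) (H : I -> Prop) n
  (rho : I -> 'M[F]_n) m (B : 'M[F]_(m, n)) L :
  simple_on H rho -> L *m B = 1%:M -> B != 0.
Proof.
move=> [n0 _] LB; apply/eqP => B0; move: LB; rewrite B0 mulmx0.
move=> /matrixP/(_ (Ordinal n0) (Ordinal n0)); rewrite !mxE eqxx => /eqP.
by rewrite eq_sym oner_eq0.
Qed.

(* Here L' is the projection onto the quotient by the column space of B, and
   C is a section of it. *)
Lemma split_quotient (F : fieldType) n r (B : 'M[F]_(n, r)) L :
  L *m B = 1%:M ->
  exists (L' : 'M[F]_(n - r, n)) C,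
    [/\ L' *m B = 0, L' *m C = 1%:M & B *m L + C *m L' = 1%:M].
Proof.
move=> LB.
have rB : \rank B = r.
  rewrite -mxrank_tr; apply/eqnP/row_freeP; exists L^T.
  by rewrite -trmx_mul LB trmx1.
have [K K0 [Kfree KE]] : exists2 K : 'M[F]_(n - r, n), K *m B = 0 &
   row_free K /\ forall p (X : 'M[F]_(p, n)), X *m B = 0 -> (X <= K)%MS.
  have : (n - r)%N = \rank (kermx B) by rewrite mxrank_ker rB.
  move=> ->; exists (row_base (kermx B)).
    by apply/sub_kermxP; rewrite eq_row_base.
  split=> [|p X /sub_kermxP]; first exact: row_base_free.
  by rewrite eq_row_base.
(* The rows of [1%:M - B *m L] annihilate [B], so they are combinations of the rows of [K]; the
   section holds the coefficients. *)
exists K, ((1%:M - B *m L) *m pinvmx K).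
have CK : (1%:M - B *m L) *m pinvmx K *m K = 1%:M - B *m L.
  by rewrite mulmxKpV // KE // mulmxBl mul1mx -mulmxA LB mulmx1 subrr.
split=> //; last by rewrite CK addrC subrK.
apply: (row_free_inj Kfree); rewrite -mulmxA CK mulmxBr mulmx1 mulmxA K0.
by rewrite mul0mx subr0 mul1mx.
Qed.

Lemma trace_split (F : fieldType) n r s (B : 'M[F]_(n, r)) L C
    (L' : 'M[F]_(s, n)) (X : 'M[F]_n) :
  B *m L + C *m L' = 1%:M ->
  \tr X = \tr (L *m X *m B) + \tr (L' *m X *m C).
Proof.
move=> BLC; rewrite -[X in LHS]mulmx1 -BLC mulmxDr mxtraceD !mulmxA.
by rewrite [\tr (X *m B *m L)]mxtrace_mulC [\tr (X *m C *m _)]mxtrace_mulC !mulmxA.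
Qed.

Section Eigenvector.
Variable F : closedFieldType.

(** By Cayley-Hamilton the product of the [A - c], over the roots [c] of the characteristic
    polynomial, kills [v]. Applying the factors one at a time preserves [P], and the last nonzero
    vector is an eigenvector. *)
Lemma stable_eigenrow n (A : 'M[F]_n) (P : 'rV[F]_n -> Prop) v :
  (forall c w, P w -> P (w *m A - c *: w)) -> P v -> v != 0 ->
  exists c w, [/\ P w, w != 0 & w *m A = c *: w].
Proof.
case: n A P v => [|n] A P v Pst; first by rewrite [v]thinmx0 eqxx.
have [r rE] := closed_field_poly_normal (char_poly A).
have : v *m horner_mx A (\prod_(c <- r) ('X - c%:P)) = 0.
  have := Cayley_Hamilton A.
  rewrite rE (monicP (char_poly_monic A)) scale1r => ->.
  by rewrite mulmx0.
elim: r v {rE} => [|c r IH] v.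
  by rewrite big_nil rmorph1 mulmx1 => ->; rewrite eqxx.
rewrite big_cons rmorphM rmorphB /= horner_mx_X horner_mx_C mulmxA.
rewrite mulmxBr mul_mx_scalar => vr Pv v0.
have [vc|vc] := eqVneq (v *m A - c *: v) 0.
  by exists c, v; split=> //; apply/eqP; rewrite -subr_eq0 vc.
exact: IH vr (Pst _ _ Pv) vc.
Qed.

Lemma stable_eigenvector m n (f : {linear 'M[F]_(m, n) -> 'M[F]_(m, n)})
    (P : 'M[F]_(m, n) -> Prop) B :
  (forall c X, P X -> P (f X - c *: X)) -> P B -> B != 0 ->
  exists c X, [/\ P X, X != 0 & f X = c *: X].
Proof.
move=> Pst PB B0.
have [|||c [w [Pw w0 wE]]] :=
  @stable_eigenrow _ (lin_mx f) (fun w => P (vec_mx w)) (mxvec B).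
- by move=> c w Pw; rewrite mul_rV_lin linearB linearZ /= mxvecK; apply: Pst.
- by rewrite mxvecK.
- by rewrite mxvec_eq0.
exists c, (vec_mx w); split=> //; first by rewrite vec_mx_eq0.
by move: wE; rewrite mul_rV_lin => /(congr1 vec_mx); rewrite mxvecK linearZ.
Qed.

End Eigenvector.

Lemma linear_pred_vspace (F : fieldType) (V : vectType F) (P : V -> Prop) :
  P 0 -> (forall c u v, P u -> P v -> P (c *: u + v)) ->
  exists W : {vspace V}, forall v, v \in W <-> P v.
Proof.
move=> P0 Plin.
(* [m] bounds the codimension of [W]; adjoining a vector of [P] outside [W] lowers it. *)
have sub m (W : {vspace V}) : (\dim {:V} <= \dim W + m)%N ->
    (forall v, v \in W -> P v) -> exists W : {vspace V}, forall v, v \in W <-> P v.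
  elim: m W => [|m IH] W leW WP.
    exists W => v; split=> [/WP//|_].
    have -> : W = fullv; last exact: memvf.
    by apply/eqP; rewrite eqEdim subvf /= -[X in (_ <= X)%N]addn0.
  have [PW|] := EM (forall v, P v -> v \in W); first by exists W => v; split=> [/WP|/PW].
  move=> /existsNP[v /not_implyP[Pv /negP vW]].
  apply: (IH (<[v]> + W)%VS) => [|_ /memv_addP[_ /vlineP[c ->] [w /WP Pw ->]]].
    have -> : \dim (<[v]> + W) = (\dim W).+1; last by rewrite addSnnS.
    rewrite dimv_disjoint_sum.
      by rewrite dim_vline; case: eqVneq vW => // ->; rewrite mem0v.
    apply/eqP; rewrite -subv0; apply/subvP => _ /memv_capP[/vlineP[c ->]].
    by rewrite rpredZeq (negPf vW) orbF => /eqP ->; rewrite scale0r mem0v.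
  exact: Plin.
apply: (sub (\dim {:V}) 0%VS); first by rewrite leq_addl.
by move=> v; rewrite memv0 => /eqP ->.
Qed.

Section Independence.
Variables (F : fieldType) (I : Type) (H : I -> Prop) (n d : nat).
Variables (rho : I -> 'M[F]_n) (sigma : nat -> I -> 'M[F]_d).
Variable B : nat -> 'M[F]_(n, d).

(* If a nonzero vector of the last summand lies in the sum of the others, then by
   simplicity all of them do, which gives intertwiners into the other ones. *)
Lemma nonisomorphic_simples_independent k :
  (forall i, (i < k)%N -> simple_on H (sigma i)) ->
  (forall i g, (i < k)%N -> H g -> rho g *m B i = B i *m sigma i g) ->
  (forall i, (i < k)%N -> B i != 0) ->
  (forall i j A, (i < j < k)%N ->
     (forall g, H g -> sigma i g *m A = A *m sigma j g) -> A = 0) ->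
  forall m (A : nat -> 'M[F]_(d, m)), \sum_(i < k) B i *m A i = 0 ->
  forall i, (i < k)%N -> A i = 0.
Proof.
elim: k => // k IH simp BE Bn0 noniso.
have {}IH : forall m (A : nat -> 'M[F]_(d, m)), \sum_(i < k) B i *m A i = 0 ->
    forall i, (i < k)%N -> A i = 0.
  apply: IH => [i ik|i g ik|i ik|i j A /andP[ij jk]].
  - exact/simp/ltnW.
  - exact/BE/ltnW.
  - exact/Bn0/ltnW.
  - by apply: noniso; rewrite ij ltnW.
pose P u := exists w : nat -> 'cV_d, B k *m u = \sum_(i < k) B i *m w i.
have [||U UP] := @linear_pred_vspace _ _ P.
- by exists (fun=> 0); rewrite mulmx0 big1 // => i _; rewrite mulmx0.
- move=> c u v [a ua] [b vb]; exists (fun i => c *: a i + b i).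
  rewrite mulmxDr -scalemxAr ua vb scaler_sumr -big_split /=.
  by apply: eq_bigr => i _; rewrite mulmxDr -scalemxAr.
have [|U0|UT] := (simp k (ltnSn k)).2 U.
- move=> g v Hg /UP[w vw]; apply/UP; exists (fun i => sigma i g *m w i).
  rewrite mulmxA -BE // -mulmxA vw mulmx_sumr; apply: eq_bigr => i _.
  by rewrite !mulmxA BE //; exact/leqW.
- move=> m A; rewrite big_ord_recr /= => A0.
  have Ak : A k = 0.
    apply: eq_mulmx_cV => v; rewrite mul0mx; apply/eqP; rewrite -memv0 -U0.
    apply/UP; exists (fun i => - (A i *m v)).
    apply/eqP; rewrite mulmxA -subr_eq0 -sumrN addrC; apply/eqP.
    under eq_bigr do rewrite mulmxN opprK mulmxA.
    by rewrite -mulmx_suml -mulmxDl A0 mul0mx.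
  move: A0; rewrite Ak mulmx0 addr0 => A0 i.
  by rewrite ltnS leq_eqVlt => /predU1P[->|/(IH _ _ A0)].
have /fin_all_exists[w wE] (j : 'I_d) : P (delta_mx j 0) by apply/UP; rewrite UT memvf.
pose A i := \matrix_(a, j) w j i a 0 : 'M[F]_d.
have BA : B k = \sum_(i < k) B i *m A i.
  apply: (can_inj trmxK); apply/row_matrixP => j; rewrite -!tr_col !colE wE.
  rewrite mulmx_suml; congr (_^T); apply: eq_bigr => i _; rewrite -mulmxA.
  by congr (_ *m _); rewrite -colE; apply/colP => a; rewrite !mxE.
(* The images of the [B i], [i < k], are independent by induction; comparing coefficients in two
   expressions of [rho g *m B k] shows that [A i] is an intertwiner. *)
have A0 i : (i < k)%N -> A i = 0.
  move=> ik; apply: (noniso i k); first by rewrite ik /=.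
  move=> g Hg; apply/eqP; rewrite -subr_eq0; apply/eqP.
  apply: (IH _ (fun i => sigma i g *m A i - A i *m sigma k g)) ik.
  under eq_bigr do rewrite mulmxBr !mulmxA.
  rewrite sumrB -mulmx_suml -BA -BE // BA mulmx_sumr -sumrB big1 // => j _.
  by rewrite mulmxA BE ?subrr //; exact/leqW.
by have := Bn0 k (ltnSn k); rewrite BA big1 ?eqxx // => i _; rewrite A0 ?mulmx0.
Qed.

End Independence.

(* Burnside's theorem, by the argument of Lomonosov and Rosenthal: a nonzero
   element of A of minimal rank has rank one, and then A contains all rank one
   matrices. *)
Section Burnside.
Variables (F : closedFieldType) (n : nat) (A : 'M[F]_n -> Prop).
Hypothesis A1 : A 1%:M.
Hypothesis Alin : forall c X Y, A X -> A Y -> A (c *: X + Y).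
Hypothesis AM : forall X Y, A X -> A Y -> A (X *m Y).
Hypothesis Asimple : simple_on A id.

Let A0 : A 0.
Proof. by have := Alin (-1) A1 A1; rewrite scaleN1r addNr. Qed.

Lemma simple_transitive (u v : 'cV_n) : u != 0 -> exists2 X, A X & X *m u = v.
Proof.
move=> u0; pose P w := exists2 X, A X & X *m u = w.
have [||W WP] := @linear_pred_vspace _ _ P.
- by exists 0; rewrite ?mul0mx.
- move=> c _ _ [X AX <-] [Y AY <-]; exists (c *: X + Y); first exact: Alin.
  by rewrite mulmxDl scalemxAl.
have [|W0|WT] := Asimple.2 W.
- move=> X w AX /WP[Y AY <-]; apply/WP; exists (X *m Y); first exact: AM.
  by rewrite mulmxA.
- have : u \in W by apply/WP; exists 1%:M; rewrite ?mul1mx.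
  by rewrite W0 memv0 (negPf u0).
by apply/WP; rewrite WT memvf.
Qed.

Lemma simple_rank_one :
  exists (u : 'cV_n) (v : 'rV_n), [/\ A (u *m v), u != 0 & v != 0].
Proof.
pose P (r : nat) := exists X, [/\ A X, X != 0 & \rank X = r].
have n0 := Asimple.1.
have [r [[T [AT T0 rT]] rmin]] : exists r, P r /\ forall s, P s -> (r <= s)%N.
  apply: ex_min_nat; exists n, 1%:M; split; rewrite ?mxrank1 //.
  by rewrite -mxrank_eq0 mxrank1 -lt0n.
have [C [R [TE Cfree Rfree]]] : exists (C : 'M[F]_(n, r)) (R : 'M[F]_(r, n)),
    [/\ T = C *m R, row_free C^T & row_free R].
  rewrite -rT; exists (col_base T), (row_base T).
  rewrite mulmx_base row_base_free /row_free mxrank_tr; split=> //.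
  exact: col_base_full.
have r0 : (0 < r)%N by rewrite -rT lt0n mxrank_eq0.
(* Subtracting an eigenvalue [c] from [R *m X *m C] gives a singular [M]. Then
   [C *m M *m R = T *m X *m T - c *: T] lies in [A] with rank below [r], so it vanishes, and
   [M = 0]. *)
have scal X : A X -> exists c, R *m X *m C = c%:M.
  move=> AX; have [|||c [w [_ w0 wE]]] :=
    @stable_eigenrow F r (R *m X *m C) (fun=> True) (const_mx 1); rewrite //.
    by apply/eqP => /rowP/(_ (Ordinal r0)); rewrite !mxE => /eqP; rewrite oner_eq0.
  exists c; apply/eqP; rewrite -subr_eq0; apply/eqP.
  set M := _ - _.
  have AM' : A (C *m M *m R).
    have -> : C *m M *m R = - c *: T + T *m X *m T.
      rewrite /M mulmxBr mulmxBl mul_mx_scalar -scalemxAl -TE TE !mulmxA.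
      by rewrite addrC scaleNr.
    by apply: Alin => //; apply: AM => //; apply: AM.
  have CMR0 : C *m M *m R = 0.
    apply/eqP/negPn/negP => CMR0.
    have /rmin : P (\rank (C *m M *m R)) by exists (C *m M *m R).
    apply/negP; rewrite -ltnNge (leq_ltn_trans (mxrankM_maxl _ _)) //.
    rewrite (leq_ltn_trans (mxrankM_maxr _ _)) // ltn_neqAle rank_leq_row andbT.
    rewrite -/(row_free M); apply/negP => Mfree; case/eqP: w0.
    apply: (row_free_inj Mfree).
    by rewrite mul0mx /M mulmxBr wE mul_mx_scalar subrr.
  have CM0 : C *m M = 0 by apply: (row_free_inj Rfree); rewrite CMR0 mul0mx.
  apply: trmx_inj; apply: (row_free_inj Cfree).
  by rewrite -trmx_mul CM0 !trmx0 mul0mx.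
(* If [r >= 2], transitivity yields [X] such that [R *m X *m C] sends the first basis vector to the
   second, which no scalar does. *)
have r1 : r = 1%N.
  apply/eqP; rewrite eqn_leq r0 andbT leqNgt; apply/negP => r2.
  pose i := Ordinal r0; pose j := Ordinal r2.
  have ei0 : C *m (delta_mx i 0 : 'cV_r) != 0.
    apply/eqP => Ci0.
    have /trmx_inj : (delta_mx i 0 : 'cV[F]_r)^T = 0^T.
      by apply: (row_free_inj Cfree); rewrite -!trmx_mul Ci0 mulmx0.
    by move=> /colP/(_ i); rewrite !mxE !eqxx => /eqP; rewrite oner_eq0.
  have [X AX XE] := simple_transitive (pinvmx R *m delta_mx j 0) ei0.
  have [c cE] := scal X AX.
  have : c%:M *m delta_mx i 0 = delta_mx j 0 :> 'cV[F]_r.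
    by rewrite -cE -!mulmxA XE (mulmxA R) (mulmxVp Rfree) mul1mx.
  move=> /colP/(_ j); rewrite mul_scalar_mx !mxE /= mulr0 => /eqP.
  by rewrite eq_sym oner_eq0.
move: C R TE {Cfree Rfree scal}; rewrite r1 => u v TE; exists u, v; split.
- by rewrite -TE.
- by apply: contraNneq T0 => u0; rewrite TE u0 mul0mx.
- by apply: contraNneq T0 => v0; rewrite TE v0 mulmx0.
Qed.

Theorem Burnside X : A X.
Proof.
have [u [v [Auv u0 v0]]] := simple_rank_one.
have Au w : A (w *m v).
  by have [Y AY <-] := simple_transitive w u0; rewrite -mulmxA; apply: AM.
(* Dual transitivity: the vectors killed by all [v *m Y] form a stable subspace [W], not everything
   as [v] is nonzero. So [W] is zero, and the [v *m Y] fill the row space. *)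
have Av (w : 'rV_n) : exists2 Y, A Y & v *m Y = w.
  pose P w := exists2 Y, A Y & (v *m Y)^T = w.
  have [||Q QP] := @linear_pred_vspace _ 'cV_n P.
  - by exists 0; rewrite // mulmx0 trmx0.
  - move=> c _ _ [Y AY <-] [Z AZ <-]; exists (c *: Y + Z); first exact: Alin.
    by rewrite mulmxDr -scalemxAr linearP.
  have [B [L [LB QB]]] := vspace_colspace Q.
  have [||W WP] := @linear_pred_vspace _ 'cV_n
      (fun w => forall Y, A Y -> v *m Y *m w = 0).
  - by move=> Y _; rewrite mulmx0.
  - move=> c a b av bv Y AY.
    by rewrite mulmxDr -scalemxAr av // bv // scaler0 addr0.
  have W0 : W = 0%VS.
    have [|//|WT] := Asimple.2 W.
      move=> Y a AY /WP aW; apply/WP => Z AZ; rewrite mulmxA -(mulmxA v).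
      by apply: aW; apply: AM.
    case/eqP: v0; apply: eq_mulmx_cV => a; rewrite mul0mx -[v]mulmx1.
    by have /WP -> : a \in W by rewrite WT memvf.
  have [K KB] : exists K, K *m B^T = 1%:M.
    apply: inj_left_inverse => a Ba; apply/eqP; rewrite -memv0 -W0.
    apply/WP => Y AY; have /QB[b bE] : (v *m Y)^T \in Q by apply/QP; exists Y.
    by rewrite -[v *m Y]trmxK bE trmx_mul -mulmxA Ba mulmx0.
  have [|Y AY YE] := (QP w^T).1.
    apply/QB; exists (K^T *m w^T); rewrite mulmxA -[B]trmxK -trmx_mul KB.
    by rewrite trmx1 mul1mx.
  by exists Y => //; apply: trmx_inj.
rewrite [X]matrix_sum_delta; elim/big_ind: _ => // [Y Z AY AZ|i _].
  by rewrite -[Y]scale1r; apply: Alin.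
elim/big_ind: _ => // [Y Z AY AZ|j _]; first by rewrite -[Y]scale1r; apply: Alin.
rewrite -[_ *: _]addr0; apply: Alin => //.
have [Y AY YE] := Av (delta_mx 0 j).
rewrite -(mul_delta_mx (0 : 'I_1)) -YE mulmxA; exact: AM.
Qed.

End Burnside.

Lemma simple_trace_eq0 (F : closedFieldType) (I : Type) (H : I -> Prop) n
    (rho : I -> 'M[F]_n) (Y : 'M[F]_n) :
  simple_on H rho -> (exists2 e, H e & rho e = 1%:M) ->
  (forall g h, H g -> H h -> exists2 k, H k & rho k = rho g *m rho h) ->
  (forall g, H g -> \tr (Y *m rho g) = 0) -> Y = 0.
Proof.
move=> simp [e He rho1] rhoM Yrho.
pose Z Y := forall g, H g -> \tr (Y *m rho g) = 0.
(* The annihilator of the annihilator of [rho H] for the trace form: an algebra containing [rho H],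
   hence everything by Burnside's theorem. *)
pose A X := forall Y, Z Y -> \tr (Y *m X) = 0.
have ZM T g : Z T -> H g -> Z (T *m rho g).
  by move=> ZT Hg h Hh; have [k Hk kE] := rhoM _ _ Hg Hh; rewrite -mulmxA -kE ZT.
have AX X : A X.
  apply: (@Burnside F n A) => [|c {}X T AX AT S ZS|{}X T AX AT S ZS|].
  - by move=> T /(_ e He); rewrite rho1.
  - by rewrite mulmxDr -scalemxAr mxtraceD mxtraceZ AX // AT // mulr0 addr0.
  - rewrite mulmxA mxtrace_mulC mulmxA; apply: AX => g Hg.
    by rewrite -mulmxA mxtrace_mulC AT //; apply: ZM.
  split=> [|W Wst]; first exact: simp.1.
  apply: simp.2 => g v Hg; apply: Wst => T; exact.
apply/matrixP => i j; rewrite mxE -[RHS](AX (delta_mx j i) Y Yrho) /mxtrace.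
rewrite (bigD1 i) //= big1 ?addr0 => [|k /negPf ki]; rewrite !mxE (bigD1 j) //=.
  by rewrite big1 ?addr0 ?mxE ?eqxx ?mulr1 // => k /negPf kj; rewrite mxE kj mulr0.
by rewrite big1 ?addr0 ?mxE ?ki ?andbF ?mulr0 // => l /negPf lj; rewrite mxE lj mulr0.
Qed.

(** * Restriction to a normal subgroup with cyclic quotient *)

Section CyclicExtension.
Variables (G : groupType) (N : G -> Prop).
Hypothesis N1 : N 1%g.
Hypothesis NM : forall a b, N a -> N b -> N (a * b)%g.
Hypothesis NV : forall a, N a -> N a^-1%g.
Hypothesis NJ : forall a b, N a -> N (a ^ b)%g.

(* When a power of x lies in N, this is the subgroup <x>N: negative powers of x
   are then not needed. *)
Definition powers_mul (x y : G) : Prop :=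
  exists (i : nat) g, N g /\ y = (x ^+ i * g)%g.

Lemma powers_mul_sub x g : N g -> powers_mul x g.
Proof. by exists 0%N, g; rewrite mul1g. Qed.

Lemma powers_mulX x i : powers_mul x (x ^+ i)%g.
Proof. by exists i, 1%g; rewrite mulg1. Qed.

Lemma powers_mulM x a b :
  powers_mul x a -> powers_mul x b -> powers_mul x (a * b)%g.
Proof.
move=> [i [g [Ng ->]]] [j [h [Nh ->]]].
exists (i + j)%N, (g ^ (x ^+ j) * h)%g; split; first by apply: NM => //; apply: NJ.
by rewrite expgnDr /conjg !mulgA mulgK.
Qed.

Lemma powers_mulXX x k a : powers_mul (x ^+ k)%g a -> powers_mul x a.
Proof. by move=> [i [g [Ng ->]]]; exists (k * i)%N, g; rewrite expgnA. Qed.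

Lemma powers_mulV x e a : (0 < e)%N -> N (x ^+ e)%g ->
  powers_mul x a -> powers_mul x a^-1%g.
Proof.
move=> e0 xe [i [g [Ng ->]]]; rewrite invgM; apply: powers_mulM.
  exact/powers_mul_sub/NV.
(* The inverse of [x ^+ i] is [x ^+ (i * e.-1)] times the inverse of [x ^+ (i * e)], which lies in
   [N]. *)
exists (i * e.-1)%N, (x ^+ (i * e))^-1%g; split.
  apply: NV; rewrite mulnC expgnA; elim: i => [|i IH]; first by rewrite expg0.
  by rewrite expgS; apply: NM.
rewrite -[in X in (_ / _ ^+ X)%g](prednK e0) mulnS expgnDr invgM mulgA.
by rewrite mulgV mul1g.
Qed.

Lemma powers_mul_exp x e k : N (x ^+ e)%g -> N ((x ^+ k) ^+ e)%g.
Proof.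
move=> xe; rewrite -expgnA mulnC expgnA; elim: k => [|k IH]; first by rewrite expg0.
by rewrite expgS; apply: NM.
Qed.

Lemma powers_mul_transversal x k a : (0 < k)%N -> powers_mul x a ->
  exists j : 'I_k, powers_mul (x ^+ k)%g ((x ^+ j)^-1 * a)%g.
Proof.
move=> k0 [i [g [Ng ->]]]; exists (Ordinal (ltn_pmod i k0)), (i %/ k)%N, g.
split=> //; have -> : (x ^+ i = x ^+ (i %% k) * (x ^+ k) ^+ (i %/ k))%g.
  by rewrite -expgnA -expgnDr mulnC addnC -divn_eq.
by rewrite /= -mulgA mulKg.
Qed.

Section Representation.
Variables (x : G) (e : nat).
Hypotheses (e0 : (0 < e)%N) (xe : N (x ^+ e)%g).
Variables (F : closedFieldType) (n : nat) (rho : G -> 'M[F]_n).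
Hypothesis n0 : (0 < n)%N.
Hypothesis rho1 : rho 1%g = 1%:M.
Hypothesis rhoM : forall a b, powers_mul x a -> powers_mul x b ->
  rho (a * b)%g = rho a *m rho b.

Let sN a : N a -> powers_mul x a := @powers_mul_sub x a.
Let sX i : powers_mul x (x ^+ i)%g := powers_mulX x i.

Let rhoV a : powers_mul x a -> rho a^-1%g *m rho a = 1%:M.
Proof. by move=> xa; rewrite -rhoM ?mulVg //; apply: (powers_mulV e0). Qed.

Let rhoJ a g : powers_mul x a -> N g -> rho g *m rho a = rho a *m rho (g ^ a)%g.
Proof.
move=> xa Ng; rewrite -!rhoM ?[(g * a)%g]conjgC //; [exact/sN/NJ|exact: sN].
Qed.

(* The last clause is the minimality of k: the twists by x^i, 0 < i < k, of the
   simple representation of N on the columns of B are not isomorphic to it. *)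
Lemma stable_cyclic_simple :
  exists (k d : nat) (B : 'M[F]_(n, d)) (L : 'M[F]_(d, n)),
    [/\ (0 < k)%N, L *m B = 1%:M,
        simple_on N (fun g => L *m rho g *m B),
        forall h, powers_mul (x ^+ k)%g h -> rho h *m B = B *m (L *m rho h *m B)
      & forall i, (0 < i < k)%N -> forall T : 'M[F]_d, T \in unitmx ->
          ~ forall g, N g -> T *m (L *m rho g *m B) =
                        (L *m rho (g ^ (x ^+ i)^-1)%g *m B) *m T].
Proof.
have [d [B0 [L0 [LB0 [sigma [sE simp]]]]]] : exists d (B0 : 'M[F]_(n, d)) L0,
    L0 *m B0 = 1%:M /\ exists sigma, (forall g, N g -> rho g *m B0 = B0 *m sigma g) /\
    simple_on N sigma.
  have [d [B0 [L0 [LB0 sE simp]]]] := simple_submodule N rho n0.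
  by exists d, B0, L0; split=> //; exists (fun g => L0 *m rho g *m B0).
have B0I X Y : B0 *m X = B0 *m Y -> X = Y :> 'M[F]_d.
  by move=> /(congr1 (mulmx L0)); rewrite !mulmxA LB0 !mul1mx.
have sigmaM g h : N g -> N h -> sigma (g * h)%g = sigma g *m sigma h.
  move=> Ng Nh; apply: B0I.
  by rewrite -sE ?rhoM ?mulmxA -?sE -?mulmxA -?sE //; [apply: sN|apply: sN|apply: NM].
have sigma1 : sigma 1%g = 1%:M by apply: B0I; rewrite -sE // rho1 mul1mx mulmx1.
pose iso a := exists2 T : 'M[F]_d, T \in unitmx &
  forall g, N g -> T *m sigma g = sigma (g ^ a^-1)%g *m T.
have [k [[k0 [T Tu TE]] kmin]] : exists k, ((0 < k)%N /\ iso (x ^+ k)%g) /\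
    forall l, (0 < l)%N /\ iso (x ^+ l)%g -> (k <= l)%N.
  (* As [x ^+ e] is in [N], the twist by it is inner, so [e] is a candidate for [k]. *)
  apply: ex_min_nat; exists e; split=> //; exists (sigma (x ^+ e)%g).
    have : sigma (x ^+ e)^-1%g *m sigma (x ^+ e)%g = 1%:M.
      by rewrite -sigmaM ?mulVg //; exact: NV.
    by case/mulmx1_unit.
  move=> g Ng; rewrite -(sigmaM (x ^+ e)%g g) // (conjgCV (x ^+ e)%g) sigmaM //.
  exact: NJ.
pose P X := forall g, N g -> rho g *m X = X *m sigma g.
have TVE g : N g -> sigma (g ^ (x ^+ k))%g *m invmx T = invmx T *m sigma g.
  move=> Ng; rewrite -[RHS]mulmx1 -(mulmxV Tu) !mulmxA; congr (_ *m _).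
  rewrite -[RHS]mulmxA -[X in _ *m (sigma X *m _)](conjgK (x ^+ k)%g) -TE.
    by rewrite mulmxA mulVmx // mul1mx.
  exact: NJ.
(* [P] is the space of intertwiners from [sigma] to [rho]. An eigenvector [B] satisfies
   [rho (x ^+ k) *m B = c *: (B *m T)], so its column space is stable under [x ^+ k] as well as
   under [N]. *)
have [|||c [B [PB B_0 BE]]] := @stable_eigenvector F n d
    (mulmxr (invmx T) \o mulmx (rho (x ^+ k)%g)) P B0.
- move=> c X PX g Ng; rewrite mulmxBr mulmxBl -scalemxAr -scalemxAl PX //.
  congr (_ - _); rewrite /= !mulmxA rhoJ // -(mulmxA _ _ X) PX; last exact: NJ.
  by rewrite -!mulmxA TVE.
- exact: sE.
- exact: simple_nonzero simp LB0.
have [L LB] := simple_intertwiner_inj simp PB B_0.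
have LBE g : N g -> L *m rho g *m B = sigma g.
  by move=> Ng; rewrite -mulmxA PB // mulmxA LB mul1mx.
exists k, d, B, L; split=> //.
- split=> [|W Wst]; first exact: simp.1.
  by apply: simp.2 => g v Ng; rewrite -LBE //; apply: Wst.
- move=> _ [i [g [Ng ->]]].
  have rhoXB : rho (x ^+ k)%g *m B = B *m (c *: T).
    by rewrite -scalemxAr scalemxAl -BE /= mulmxKV.
  have [S SE] : exists S, rho ((x ^+ k) ^+ i * g)%g *m B = B *m S.
    elim: i => [|i [S SE]]; first by exists (sigma g); rewrite mul1g PB.
    exists (c *: T *m S); rewrite expgS -mulgA rhoM -?mulmxA ?SE ?mulmxA ?rhoXB //.
    by exists (k * i)%N, g; rewrite expgnA.
  by rewrite SE -mulmxA SE (mulmxA L) LB mul1mx.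
move=> i /andP[i0 ik] S Su SE; move: ik; rewrite ltnNge kmin //; split=> //.
by exists S => // g Ng; rewrite -!LBE ?SE //; exact: NJ.
Qed.

Variables (k d : nat) (B : 'M[F]_(n, d)) (L : 'M[F]_(d, n)).
Hypothesis k0 : (0 < k)%N.
Hypothesis LB : L *m B = 1%:M.
Variable sigma : G -> 'M[F]_d.
Hypothesis sigma_simple : simple_on N sigma.
Hypothesis rhoB :
  forall h, powers_mul (x ^+ k)%g h -> rho h *m B = B *m sigma h.
Hypothesis twist : forall i, (0 < i < k)%N -> forall T : 'M[F]_d, T \in unitmx ->
  ~ forall g, N g -> T *m sigma g = sigma (g ^ (x ^+ i)^-1)%g *m T.

Let rhoNB g : N g -> rho g *m B = B *m sigma g.
Proof. by move=> Ng; apply: rhoB; apply: powers_mul_sub. Qed.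

(** Otherwise [x ^+ i] would preserve the column space of [B], and its action there would be an
    isomorphism of [sigma] with its twist, against [twist]. *)
Lemma not_powers_mul_pow i : (0 < i < k)%N -> ~ powers_mul (x ^+ k)%g (x ^+ i)%g.
Proof.
move=> ik xi; have xk := powers_mulXX xi.
have [T BT] : exists T : 'M[F]_d, B *m T = rho (x ^+ i)%g *m B.
  by exists (sigma (x ^+ i)%g); rewrite rhoB.
have BI X Y : B *m X = B *m Y -> X = Y :> 'M[F]_d.
  by move=> /(congr1 (mulmx L)); rewrite !mulmxA LB !mul1mx.
have Tu : T \in unitmx.
  have : L *m rho (x ^+ i)^-1%g *m B *m T = 1%:M.
    by rewrite -!mulmxA BT (mulmxA (rho _)) rhoV // mul1mx.
  by case/mulmx1_unit.
apply: (twist ik Tu) => g Ng; apply: BI.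
rewrite [LHS]mulmxA BT -[LHS]mulmxA -rhoNB // [LHS]mulmxA -rhoM //; last exact: sN.
rewrite conjgCV rhoM //; last exact/sN/NJ.
by rewrite -[LHS]mulmxA -BT !mulmxA rhoNB //; apply: NJ.
Qed.

Lemma transversal_inj (i j : 'I_k) :
  powers_mul (x ^+ k)%g ((x ^+ i)^-1 * x ^+ j)%g -> i = j.
Proof.
have xke := powers_mul_exp k xe.
have diff a b : (a < b < k)%N -> ~ powers_mul (x ^+ k)%g ((x ^+ a)^-1 * x ^+ b)%g.
  move=> /andP[ab bk]; rewrite -{1}(subnKC (ltnW ab)) expgnDr mulKg.
  by apply: not_powers_mul_pow; rewrite subn_gt0 ab (leq_ltn_trans (leq_subr _ _)).
case: (ltngtP i j) => [ij|ji|/val_inj//] xij.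
  by case: (@diff i j); rewrite ?ij ?ltn_ord.
case: (@diff j i); rewrite ?ji ?ltn_ord //.
by have := powers_mulV e0 xke xij; rewrite invgM invgK.
Qed.

Let Bk := \mxrow_(i < k) (rho (x ^+ i)%g *m B).

(** [N] acts on the [i]-th translate through the twist [tau i]. A nonzero intertwiner between
    [tau i] and [tau j], [i < j], is invertible and makes the twist by [x ^+ (j - i)] isomorphic to
    [sigma], which [twist] excludes. *)
Lemma translates_independent : exists Lk, Lk *m Bk = 1%:M.
Proof.
have B_0 := simple_nonzero sigma_simple LB.
pose tau (i : nat) g := sigma (g ^ (x ^+ i))%g.
have tau_simple i : simple_on N (tau i).
  split=> [|W Wst]; first exact: sigma_simple.1.
  apply: sigma_simple.2 => g v Ng vW.
  by rewrite -(conjgKV (x ^+ i)%g g); apply: Wst => //; apply: NJ.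
apply: inj_left_inverse => u.
rewrite -[u]submxcolK mul_mxrow_mxcol => u0.
pose A (i : nat) : 'M[F]_(d, 1) := oapp (fun j : 'I_k => submxcol u j) 0 (insub i).
have A0 : forall i, (i < k)%N -> A i = 0.
  apply: (@nonisomorphic_simples_independent F G N n d rho tau
            (fun i => rho (x ^+ i)%g *m B)).
  - by [].
  - move=> i g ik Ng; rewrite mulmxA rhoJ // -[LHS]mulmxA.
    by rewrite (rhoNB (NJ _ Ng)) mulmxA.
  - move=> i ik; apply: contraNneq B_0 => xB.
    by rewrite -[B]mul1mx -(rhoV (sX i)) -mulmxA xB mulmx0.
  - move=> i j T /andP[ij jk] TE; apply/eqP/negPn/negP => T0.
    have [S ST] := simple_intertwiner_inj (tau_simple j) TE T0.
    have [_ Tu] := mulmx1_unit ST.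
    have ji : (0 < j - i < k)%N by rewrite subn_gt0 ij (leq_ltn_trans (leq_subr _ _)).
    apply: (twist ji Tu) => g Ng.
    have := TE (g ^ (x ^+ j)^-1)%g (NJ _ Ng); rewrite /tau conjgKV => <-.
    congr (sigma _ *m _); rewrite -conjgM; congr conjg.
    by rewrite -{1}(subnKC (ltnW ij)) expgnDr invgM mulgVK.
  - rewrite -[RHS]u0; apply: eq_bigr => i _; congr (_ *m _).
    by rewrite /A valK.
rewrite -[0]mxcol0; apply: eq_mxcol => i.
by have := A0 i (ltn_ord i); rewrite /A valK.
Qed.

(* phi is the character of sigma extended by zero, so that the sum is the
   character induced by it. *)
Lemma translates_trace Lk g (phi : G -> F) : Lk *m Bk = 1%:M ->
  powers_mul x g ->
  (forall h, powers_mul (x ^+ k)%g h -> phi h = \tr (sigma h)) ->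
  (forall h, ~ powers_mul (x ^+ k)%g h -> phi h = 0) ->
  rho g *m Bk = Bk *m (Lk *m rho g *m Bk) /\
  \tr (Lk *m rho g *m Bk) = \sum_(i < k) phi (g ^ (x ^+ i))%g.
Proof.
move=> LBk xg phiE phi0.
have step (i : 'I_k) : exists (j : 'I_k) h, powers_mul (x ^+ k)%g h /\
    (g * x ^+ i = x ^+ j * h)%g.
  have [j xj] : exists j : 'I_k, powers_mul (x ^+ k)%g ((x ^+ j)^-1 * (g * x ^+ i))%g.
    by apply: powers_mul_transversal => //; apply: powers_mulM.
  by exists j, ((x ^+ j)^-1 * (g * x ^+ i))%g; rewrite mulVKg.
have [j /fin_all_exists[h jh]] := fin_all_exists step.
(* [g] sends the [i]-th translate to the [j i]-th through [sigma (h i)], so it acts on the columns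
   of [Bk] by a block monomial matrix. *)
pose M := \mxblock_(a < k, i < k) (if a == j i then sigma (h i) else 0).
have BkM : rho g *m Bk = Bk *m M.
  rewrite mul_mxrow mul_mxrow_mxblock; apply: eq_mxrow => i.
  rewrite (bigD1 (j i)) //= eqxx big1 ?addr0 => [|a /negPf ->]; last first.
    by rewrite mulmx0.
  have [xh hE] := jh i.
  rewrite [LHS]mulmxA -rhoM // hE (rhoM (sX _) (powers_mulXX xh)).
  by rewrite -[LHS]mulmxA rhoB // [LHS]mulmxA.
have LM : Lk *m rho g *m Bk = M.
  by rewrite -(mulmxA Lk) BkM (mulmxA Lk) LBk mul1mx.
split; first by rewrite LM.
rewrite LM mxtrace_mxblock; apply: eq_bigr => i _.
have [xh hE] := jh i.
have gE : (g ^ (x ^+ i) = (x ^+ i)^-1 * x ^+ j i * h i)%g.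
  by rewrite /conjg hE mulgA.
(* If [j i = i], then [h i] is [g ^ (x ^+ i)]; otherwise the diagonal block is zero and this
   conjugate lies outside [<x^k>N]. *)
case: eqVneq => [ij|ij]; first by rewrite gE -ij mulVg mul1g phiE.
rewrite mxtrace0 phi0 // gE => xkh.
case/eqP: ij; apply: transversal_inj; rewrite -[X in powers_mul _ X](mulgK (h i)).
by apply: powers_mulM => //; apply: (powers_mulV e0 (powers_mul_exp k xe)).
Qed.

End Representation.

End CyclicExtension.

(** * Topology *)

Lemma mulmx_continuous (K : numFieldType) m n p q (L : 'M[K]_(p, m))
    (B : 'M[K]_(n, q)) : continuous (fun X : 'M[K]_(m, n) => L *m X *m B).
Proof.
move=> X; have entry i j : (fun Y : 'M[K]_(m, n) => (L *m Y *m B) i j) @ X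
    --> (L *m X *m B) i j.
  have E (Y : 'M[K]_(m, n)) : (L *m Y *m B) i j =
      \sum_b \sum_a L i a * Y a b * B b j.
    by rewrite mxE; apply: eq_bigr => b _; rewrite mxE mulr_suml.
  under eq_fun do rewrite E; rewrite E.
  apply: cvg_big => [||b _]; [exact: add_continuous|exact: nbhs_filter|].
  apply: cvg_big => [||a _]; [exact: add_continuous|exact: nbhs_filter|].
  apply: (@cvgM _ _ _ (nbhs_filter X)); last exact: cvg_cst.
  apply: (@cvgM _ _ _ (nbhs_filter X)); first exact: cvg_cst.
  exact: coord_continuous.
move=> A [P PX PA].
apply: (@filterS _ (nbhs X) (nbhs_filter X)
  (fun Y => forall i j, P i j ((L *m Y *m B) i j))) => [Y|]; first exact: PA.
apply: (@filter_forall _ _ (fun i Y => forall j, P i j ((L *m Y *m B) i j))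
  (nbhs X) (nbhs_filter X)) => i.
apply: (@filter_forall _ _ (fun j Y => P i j ((L *m Y *m B) i j))
  (nbhs X) (nbhs_filter X)) => j.
exact: entry (PX i j).
Qed.

Lemma continuous_mulmx_subspace (R : realType) (T : topologicalType) (H K : set T)
    n m (rho : T -> 'M[CC R]_n) (L : 'M[CC R]_(m, n))
    (B : 'M[CC R]_(n, m)) :
  H `<=` K -> {within K, continuous rho} ->
  {within H, continuous (fun h => L *m rho h *m B)}.
Proof.
move=> HK /(continuous_subspaceW HK) rhoC x.
exact: (continuous_comp (rhoC x) (@mulmx_continuous _ _ _ _ _ L B _)).
Qed.

Lemma left_coset_open (G : topologicalGroupType) (N : set G) (a : G) :
  open N -> open (left_coset a N).
Proof.
move=> oN; have -> : left_coset a N = (fun y => (a^-1 * y)%g) @^-1` N.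
  rewrite predeqE => y; split=> [[n Nn <-]|Ny]; first by rewrite /= mulKg.
  by exists (a^-1 * y)%g; rewrite // mulVKg.
apply: open_comp => // y _.
apply: (@continuous_comp _ _ _ (fun y => (a^-1, y)%g)
  (fun xy : G * G => (xy.1 * xy.2)%g)).
  by apply: cvg_pair => //; exact: cvg_cst.
exact: mulg_continuous.
Qed.

Lemma compact_transversal (G : topologicalGroupType) (N : set G) :
  compact [set: G] -> open N -> N 1%g ->
  (forall a b : G, N a -> N b -> N (a * b)%g) -> (forall a : G, N a -> N a^-1%g) ->
  exists (I : finType) (rep : I -> G) (cls : G -> I), cancel rep cls /\
    forall a b, cls a = cls b <-> N (a^-1 * b)%g.
Proof.
move=> cG oN N1 NM NV.
have cosetE (a b : G) : left_coset a N = left_coset b N <-> N (a^-1 * b)%g.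
  split=> [ab|Nab].
    have : left_coset b N b by exists 1%g; rewrite ?mulg1.
    by rewrite -ab => -[c Nc <-]; rewrite mulKg.
  rewrite predeqE => y; split=> [[c Nc <-]|[c Nc <-]].
    exists ((a^-1 * b)^-1 * c)%g; first by apply: NM => //; apply: NV.
    by rewrite invgM invgK !mulgA mulgV mul1g.
  exists ((a^-1 * b) * c)%g; first exact: NM.
  by rewrite !mulgA mulgV mul1g.
have [s sP] : exists s : seq G, forall y, exists2 a, a \in s & left_coset a N y.
  apply: contrapT => nos.
  (* The filter generated by the complements of finite unions of cosets is proper if no such union
     is [G]. A cluster point [a] would then make the coset of [a] meet its own complement. *)
  pose F := [set S : set G | exists s : seq G, forall y,
    (forall a, a \in s -> ~ left_coset a N y) -> S y].
  have FF : ProperFilter F.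
    split.
      move=> [s sE]; apply: nos; exists s => y; apply: contrapT => ny.
      by apply: (sE y) => a sa ay; apply: ny; exists a.
    split=> [|S T [s sS] [t tT]|S T ST [s sS]].
    - by exists [::].
    - exists (s ++ t) => y sty.
      by split; [apply: sS|apply: tT] => a ia; apply: sty; rewrite mem_cat ia ?orbT.
    - by exists s => y /sS /ST.
  have [|a [_ /(_ (~` left_coset a N) (left_coset a N))]] := cG F FF.
    by exists [::].
  case.
  - by exists [:: a] => y; apply; rewrite mem_head.
  - apply: open_nbhs_nbhs; split; first exact: left_coset_open.
    by exists 1%g; rewrite ?mulg1.
  - by move=> y [].
pose r := [seq left_coset a N | a <- s].
have rP y : left_coset y N \in r.
  have [a sa [c Nc cy]] := sP y; apply/mapP; exists a => //.
  by apply/esym/cosetE; rewrite -cy mulKg.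
exists (seq_sub r), (fun X => xget 1%g (ssval X)), (fun y => SeqSub (rP y)); split.
  move=> X; apply: val_inj => /=; have /mapP[a _ Xa] := valP X.
  have : ssval X (xget 1%g (ssval X)).
    by apply: (@xgetI _ _ _ a); rewrite Xa; exists 1%g; rewrite ?mulg1.
  rewrite [in X in X _ -> _]Xa => -[c Nc cE]; rewrite Xa.
  by apply/esym/cosetE; rewrite -Xa -cE mulKg.
move=> a b; rewrite -cosetE; split=> [[]//|ab].
exact: val_inj.
Qed.

(** * Induced class functions *)

Lemma subgroupP (G : groupType) (H : set G) : subgroup H <->
  [/\ H 1%g, forall a b, H a -> H b -> H (a * b)%g & forall a, H a -> H a^-1%g].
Proof.
split=> [[/set_mem H1 HF]|[H1 HM HV]].
  have HV a : H a -> H a^-1%g.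
    by move=> Ha; have := HF _ _ (mem_set H1) (mem_set Ha); rewrite mul1g => /set_mem.
  split=> // a b Ha Hb.
  by have := HF _ _ (mem_set Ha) (mem_set (HV b Hb)); rewrite invgK => /set_mem.
split=> [|a b /set_mem Ha /set_mem Hb]; apply: mem_set => //.
by apply: HM => //; apply: HV.
Qed.

Definition class_function (G : groupType) (T : Type) (H : set G) (f : G -> T) :=
  forall y h, H y -> H h -> f (y ^ h)%g = f y.

Lemma patchE (T : Type) (V : zmodType) (H : set T) (f : T -> V) a :
  patch (fun=> 0) H f a = if `[< H a >] then f a else 0.
Proof. by []. Qed.

Section Induction.
Variables (R : realType) (G : topologicalGroupType) (N : set G).
Hypothesis Nnormal : normal_subgroup N.
Variables (I : finType) (rep : I -> G) (cls : G -> I).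
Hypothesis repK : cancel rep cls.
Hypothesis clsE : forall a b, cls a = cls b <-> N (a^-1 * b)%g.

Let N1 : N 1%g. Proof. by have [/subgroupP[]] := Nnormal. Qed.
Let NM a b : N a -> N b -> N (a * b)%g.
Proof. by have [/subgroupP[]] := Nnormal; auto. Qed.
Let NV a : N a -> N a^-1%g. Proof. by have [/subgroupP[]] := Nnormal; auto. Qed.
Let NJ a b : N a -> N (a ^ b)%g. Proof. by have [_] := Nnormal; apply. Qed.

Definition coset_invariant (T : Type) (Phi : G -> T) :=
  forall a n, N n -> Phi (a * n)%g = Phi a.

Lemma coset_invariantE T (Phi : G -> T) a b :
  coset_invariant Phi -> cls a = cls b -> Phi a = Phi b.
Proof. by move=> PhiN /clsE Nab; rewrite -(PhiN a _ Nab) mulVKg. Qed.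

Lemma coset_sum_mull (V : nmodType) (Phi : G -> V) b : coset_invariant Phi ->
  \sum_i Phi (b * rep i)%g = \sum_i Phi (rep i).
Proof.
move=> PhiN; rewrite [RHS](reindex_inj (h := fun i => cls (b * rep i)%g)).
  by apply: eq_bigr => i _; apply: coset_invariantE => //; rewrite repK.
move=> i j /clsE; rewrite invgM -mulgA mulKg => /clsE.
by rewrite !repK.
Qed.

(** Right multiplication by [b] permutes the left cosets because [N] is normal. *)
Lemma coset_sum_mulr (V : nmodType) (Phi : G -> V) b : coset_invariant Phi ->
  \sum_i Phi (rep i * b)%g = \sum_i Phi (rep i).
Proof.
move=> PhiN; rewrite [RHS](reindex_inj (h := fun i => cls (rep i * b)%g)).
  by apply: eq_bigr => i _; apply: coset_invariantE => //; rewrite repK.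
move=> i j /clsE; rewrite invgM => /(NJ b^-1%g).
rewrite /conjg invgK !mulgA mulgV mul1g mulgK => /clsE.
by rewrite !repK.
Qed.

Definition indicator (H : set G) (a : G) : CC R := `[< H a >]%:R.

(* For a subgroup H containing N, this is the index of N in H. *)
Definition coset_count (H : set G) : nat := \sum_i `[< H (rep i) >].

Lemma indicator_sum H : \sum_i indicator H (rep i) = (coset_count H)%:R.
Proof. by rewrite /coset_count natr_sum. Qed.

Section Subgroup.
Variable H : set G.
Hypotheses (subH : subgroup H) (NH : N `<=` H).

Let H1 : H 1%g. Proof. by case/subgroupP: subH. Qed.
Let HM a b : H a -> H b -> H (a * b)%g. Proof. by case/subgroupP: subH; auto. Qed.
Let HV a : H a -> H a^-1%g. Proof. by case/subgroupP: subH; auto. Qed.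

Lemma subgroup_mull a b : H a -> H (a * b)%g <-> H b.
Proof.
move=> Ha; split=> [Hab|]; last exact: HM.
by rewrite -(mulKg a b); apply: HM => //; apply: HV.
Qed.

Lemma subgroup_mulr a b : H b -> H (a * b)%g <-> H a.
Proof.
move=> Hb; split=> [Hab|Ha]; last exact: HM.
by rewrite -(mulgK b a); apply: HM => //; apply: HV.
Qed.

Lemma subgroup_conj a b : H b -> H (a ^ b)%g <-> H a.
Proof. by move=> Hb; rewrite subgroup_mull ?subgroup_mulr //; apply: HV. Qed.

Lemma coset_count_gt0 : (0 < coset_count H)%N.
Proof.
rewrite /coset_count (bigD1 (cls 1%g)) //= asboolT // -[X in H X]invgK.
apply/HV/NH/NV; rewrite -[rep _]mul1g -{1}invg1; apply/clsE.
by rewrite repK.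
Qed.

Lemma coset_count_neq0 : (coset_count H)%:R != 0 :> CC R.
Proof. by rewrite pnatr_eq0 -lt0n coset_count_gt0. Qed.

Lemma indicator_mulr a h : H h -> indicator H (a * h)%g = indicator H a.
Proof. by move=> Hh; rewrite /indicator (propext (subgroup_mulr a Hh)). Qed.

(** The coset [yH] splits into [coset_count H] cosets of [N], on which [Phi] takes the value
    [Phi y]. *)
Lemma sum_over_coset y (Phi : G -> CC R) :
  (forall a h, H h -> Phi (a * h)%g = Phi a) ->
  \sum_i indicator H (y^-1 * rep i)%g * Phi (rep i) = (coset_count H)%:R * Phi y.
Proof.
move=> PhiH; rewrite -indicator_sum mulr_suml.
rewrite -(coset_sum_mull (Phi := fun a => indicator H (y^-1 * a)%g * Phi a) y).
  apply: eq_bigr => i _; rewrite mulKg /indicator.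
  by case: asboolP => [Hi|_]; rewrite ?mul0r // PhiH.
move=> a n Nn; rewrite mulgA indicator_mulr ?PhiH //; exact: NH.
Qed.

Lemma patch_mulr f g : class_function H f ->
  forall a h, H h ->
    patch (fun=> 0 : CC R) H f (g ^ (a * h))%g = patch (fun=> 0) H f (g ^ a)%g.
Proof.
move=> fH a h Hh; rewrite conjgM !patchE.
rewrite (propext (subgroup_conj (g ^ a)%g Hh)).
by case: asboolP => // Hga; rewrite fH.
Qed.

Section Transversal.
Variables (K : set G) (f : G -> CC R) (g : G).
Hypothesis HK : H `<=` K.
Hypothesis subK : subgroup K.
Hypothesis fH : class_function H f.

Let phi a := patch (fun=> 0 : CC R) H f (g ^ a)%g.

Lemma coset_phi a h : H h -> phi (a * h)%g = phi a.
Proof. exact: patch_mulr. Qed.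

(** Summing over the cosets of [N] in [K] counts each coset of [H] [coset_count H] times. All
    inductions thus become sums over the single finite type [I], which can be exchanged and
    reindexed. *)
Lemma Ind_sum : Ind H K f g =
  (coset_count H)%:R^-1 * \sum_i indicator K (rep i) * phi (rep i).
Proof.
have KM a h : H h -> K (a * h)%g <-> K a.
  case/subgroupP: subK => K1 KM KV Hh; split=> [Kah|Ka]; last exact/KM/HK.
  by rewrite -(mulgK h a); apply: KM => //; apply/KV/HK.
have cosetP a b : left_coset a H b <-> H (a^-1 * b)%g.
  split=> [[h Hh <-]|Hab]; first by rewrite mulKg.
  by exists (a^-1 * b)%g; rewrite // mulVKg.
have cosetE a b : H (a^-1 * b)%g -> left_coset a H = left_coset b H.
  move=> Hab; rewrite predeqE => y; rewrite !cosetP.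
  have -> : (a^-1 * y = (a^-1 * b) * (b^-1 * y))%g by rewrite mulgA mulgK.
  exact: subgroup_mull.
pose r := [seq left_coset (rep i) H | i <- enum I & `[< K (rep i) >]].
have rP X : left_cosets H K X <-> X \in undup r.
  rewrite mem_undup; split=> [[a Ka <-]|/mapP[i]].
    have aE : N (a^-1 * rep (cls a))%g by apply/clsE; rewrite repK.
    apply/mapP; exists (cls a); last exact/cosetE/NH.
    rewrite mem_filter mem_enum andbT; apply/asboolP.
    by rewrite -(mulVKg a (rep _)); apply/KM => //; apply: NH.
  rewrite mem_filter => /andP[/asboolP Ki _] ->; by exists (rep i).
have -> : Ind H K f g = \sum_(X <- undup r) phi (xget 1%g X).
  rewrite fsbig_seq ?undup_uniq // /Ind.
  have -> // : left_cosets H K = [set` undup r].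
  by rewrite predeqE => X; exact: rP.
apply: (mulfI coset_count_neq0); rewrite mulVKf ?coset_count_neq0 // mulr_sumr.
transitivity (\sum_(X <- undup r) \sum_i
    indicator H ((xget 1%g X)^-1 * rep i)%g * phi (rep i)).
  by apply: eq_bigr => X _; rewrite sum_over_coset //; exact: coset_phi.
rewrite exchange_big /=; apply: eq_bigr => i _.
(* If [rep i] is in [K], it lies in exactly one coset of [H] in [K]; otherwise in none. *)
suff <- : \sum_(X <- undup r) indicator H ((xget 1%g X)^-1 * rep i)%g =
    indicator K (rep i).
  by rewrite mulr_suml.
have xgetE X : X \in undup r ->
    K (xget 1%g X) /\ X = left_coset (xget 1%g X) H.
  move=> /rP[a Ka <-]; have : left_coset a H (xget 1%g (left_coset a H)).
    by apply: (@xgetI _ _ _ a); exists 1%g; rewrite ?mulg1.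
  by move=> /cosetP Hax; split; [rewrite -(mulVKg a (xget _ _)); apply/KM|exact: cosetE].
have [Ki|nKi] := pselect (K (rep i)); last first.
  rewrite {2}/indicator asboolF // big_seq big1 // => X /xgetE[KX _].
  rewrite /indicator asboolF // => HXi; apply: nKi.
  by rewrite -(mulVKg (xget 1%g X) (rep i)); apply/KM.
have ri : left_coset (rep i) H \in undup r by apply/rP; exists (rep i).
rewrite {2}/indicator asboolT // (bigD1_seq _ ri) ?undup_uniq //.
rewrite big1_seq => [|X /andP[Xi Xr]].
  have [_ /esym iE] := xgetE _ ri; rewrite /= addr0 /indicator asboolT //.
  by apply/cosetP; rewrite iE; exists 1%g; rewrite ?mulg1.
have [_ XE] := xgetE _ Xr; rewrite /indicator asboolF // => HXi; case/eqP: Xi.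
by rewrite XE; exact: cosetE.
Qed.

Lemma Ind_transversal (J : finType) (t : J -> G) :
  (forall j, K (t j)) ->
  (forall a, K a -> exists j, H ((t j)^-1 * a)%g) ->
  (forall i j, H ((t i)^-1 * t j)%g -> i = j) ->
  Ind H K f g = \sum_j phi (t j).
Proof.
move=> tK tex tinj; rewrite Ind_sum.
apply: (mulfI coset_count_neq0); rewrite mulVKf ?coset_count_neq0 // mulr_sumr.
transitivity (\sum_j \sum_i indicator H ((t j)^-1 * rep i)%g * phi (rep i)); last first.
  by apply: eq_bigr => j _; rewrite sum_over_coset //; exact: coset_phi.
rewrite exchange_big /=; apply: eq_bigr => i _.
suff -> : indicator K (rep i) = \sum_j indicator H ((t j)^-1 * rep i)%g.
  by rewrite mulr_suml.
have [Ki|nKi] := pselect (K (rep i)); last first.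
  rewrite {1}/indicator asboolF // big1 // => j _; rewrite /indicator asboolF // => Hji.
  apply: nKi; rewrite -(mulVKg (t j) (rep i)).
  by case/subgroupP: subK => _ KM _; apply: KM => //; apply: HK.
have [j Hj] := tex _ Ki; rewrite {1}/indicator asboolT // (bigD1 j) // big1 => [|l lj].
  by rewrite /= addr0 /indicator asboolT.
rewrite /indicator asboolF // => Hl; case/eqP: lj; apply: tinj.
have -> : ((t l)^-1 * t j = (t l)^-1 * rep i * ((t j)^-1 * rep i)^-1)%g.
  by rewrite invgM invgK mulgA mulgK.
by apply: HM => //; apply: HV.
Qed.

End Transversal.
End Subgroup.

Lemma Ind_setT H f g : subgroup H -> N `<=` H -> class_function H f ->
  Ind H [set: G] f g =
  (coset_count H)%:R^-1 * \sum_i patch (fun=> 0 : CC R) H f (g ^ rep i)%g.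
Proof.
move=> subH NH fH; rewrite Ind_sum //; last by apply/subgroupP.
by congr (_ * _); apply: eq_bigr => i _; rewrite /indicator asboolT // mul1r.
Qed.

Lemma Ind_trans K f (m : nat) (q : 'I_m -> rat) (H : 'I_m -> set G)
    (psi : 'I_m -> G -> CC R) :
  subgroup K -> N `<=` K -> class_function K f ->
  (forall l, [/\ subgroup (H l), N `<=` H l, H l `<=` K &
     class_function (H l) (psi l)]) ->
  (forall g, K g -> f g = \sum_l ratr (q l) * Ind (H l) K (psi l) g) ->
  forall g, Ind K [set: G] f g = \sum_l ratr (q l) * Ind (H l) [set: G] (psi l) g.
Proof.
move=> subK NK fK HP fE g.
have patchf y : patch (fun=> 0) K f y = \sum_l ratr (q l) *
    ((coset_count (H l))%:R^-1 * \sum_i indicator K y * indicator K (rep i) *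
      patch (fun=> 0) (H l) (psi l) (y ^ rep i)%g).
  rewrite patchE /indicator; case: asboolP => [Ky|_]; last first.
    rewrite big1 // => l _; rewrite big1 ?mulr0 // => i _.
    by rewrite !mul0r.
  rewrite fE //; apply: eq_bigr => l _; have [subH NH HK psiH] := HP l.
  by rewrite Ind_sum //; do 2!congr (_ * _); apply: eq_bigr => i _; rewrite mul1r.
rewrite Ind_setT //; under eq_bigr do rewrite patchf.
rewrite exchange_big mulr_sumr; apply: eq_bigr => l _.
have [subH NH HK psiH] := HP l; rewrite Ind_setT //.
rewrite -!mulr_sumr mulrCA; congr (_ * _); rewrite mulrCA; congr (_ * _).
apply: (mulfI (coset_count_neq0 subK NK)); rewrite mulVKf ?coset_count_neq0 //.
rewrite exchange_big -indicator_sum mulr_suml; apply: eq_bigr => i _ /=.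
pose Phi a := patch (fun=> 0 : CC R) (H l) (psi l) (g ^ a)%g.
have PhiN : coset_invariant Phi.
  by move=> a n Nn; apply: (patch_mulr subH) => //; apply: NH.
(* For [rep i] in [K], replacing [rep j] by [rep j * rep i] absorbs the inner conjugation, so all
   these [i] contribute the same sum. *)
rewrite -(coset_sum_mulr (rep i) PhiN) mulr_sumr; apply: eq_bigr => j _.
rewrite /Phi conjgM patchE /indicator.
case: (asboolP (K (rep i))) => [Ki|_]; last by rewrite mulr0 !mul0r.
case: (asboolP (H l _)) => [Hji|_]; last by rewrite !mulr0.
rewrite asboolT ?mul1r //; apply/(subgroup_conj subK _ Ki).
exact: HK.
Qed.

End Induction.

(** * Artin induction and the main theorem *)

(* Moebius inversion; the weight of a class of equivalent elements is shared
   equally among them. *)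
Lemma preorder_weights (I : finType) (le : rel I) :
  reflexive le -> transitive le ->
  exists a : I -> rat, forall i, \sum_(j | le i j) a j = 1.
Proof.
move=> lexx letr.
pose lt i j := le i j && ~~ le j i.
have eq_le j l : le j l -> le l j ->
    (forall k, le j k = le l k) /\ (forall k, le k j = le k l).
  move=> jl lj; split=> k; apply/idP/idP => h.
  - exact: letr lj h.
  - exact: letr jl h.
  - exact: letr h jl.
  - exact: letr h lj.
(* Weights are built by increasing height: the sum at an element involves only its own class and
   elements of smaller height. *)
pose height i := #|[pred j | lt i j]|.
have heightS i j : lt i j -> (height j < height i)%N.
  move=> ij; apply/proper_card/properP; split.
    apply/fintype.subsetP => l; rewrite !inE; move: ij => /andP[ij ji] /andP[jl lj].
    rewrite /lt (letr _ _ _ ij jl) /=; apply: contra lj => li.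
    exact: letr li ij.
  by exists j; rewrite !inE // /lt lexx.
have [a aP] : exists a : I -> rat, forall i, (height i < #|I|.+1)%N ->
    \sum_(j | le i j) a j = 1.
  elim: #|I|.+1 => [|m [a aP]]; first by exists (fun=> 0).
  pose c i := #|[pred j | le i j && le j i]|.
  pose b i := (1 - \sum_(j | lt i j) a j) / (c i)%:R.
  exists (fun i => if height i == m then b i else a i) => i.
  have eq_height j l : le j l -> le l j -> height j = height l.
    move=> jl lj; have [e1 e2] := eq_le _ _ jl lj.
    by apply: eq_card => k; rewrite !inE /lt e1 e2.
  rewrite ltnS leq_eqVlt => /predU1P[im|im]; last first.
    rewrite -[RHS](aP i im); apply: eq_bigr => j ij.
    suff /ltn_eqF -> : (height j < m)%N by [].
    have [ji|ji] := boolP (le j i); first by rewrite (eq_height _ _ ji ij).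
    by apply: ltn_trans im; apply: heightS; rewrite /lt ij.
  rewrite (bigID (fun j => le j i)) /=.
  rewrite (eq_bigr (fun=> b i)) => [|j /andP[ij ji]]; last first.
    have [e1 e2] := eq_le _ _ ji ij; rewrite (eq_height _ _ ji ij) im eqxx /b.
    congr (_ / _); first by congr (_ - _); apply: eq_bigl => l; rewrite /lt e1 e2.
    by congr _%:R; apply: eq_card => l; rewrite !inE e1 e2.
  rewrite sumr_const -[X in _ *+ X]/(c i) -[b i *+ _]mulr_natr /b divfK; last first.
    rewrite pnatr_eq0 -lt0n; apply/card_gt0P; exists i.
    by rewrite inE lexx.
  rewrite (eq_bigr a) ?subrK // => j /andP[ij ji].
  by rewrite (ltn_eqF (leq_trans (heightS i j _) _)) ?im // /lt ij.
by exists a => i; apply: aP; rewrite ltnS max_card.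
Qed.

Lemma representationP (R : realType) (G : topologicalGroupType) (H : set G) n
    (rho : G -> 'M[CC R]_n) :
  representation H rho <-> [/\ rho 1%g = 1%:M,
    forall a b, H a -> H b -> rho (a * b)%g = rho a *m rho b &
    {within H, continuous rho}].
Proof.
split=> -[rho1 rhoM rhoC]; split=> //.
  by move=> a b Ha Hb; apply: rhoM; apply: mem_set.
by move=> a b /set_mem Ha /set_mem Hb; apply: rhoM.
Qed.

Lemma representation_class_function (R : realType) (G : topologicalGroupType)
    (H : set G) n (rho : G -> 'M[CC R]_n) :
  subgroup H -> representation H rho -> class_function H (fun g => \tr (rho g)).
Proof.
move=> /subgroupP[H1 HM HV] /representationP[rho1 rhoM _] y h Hy Hh.
have Hh' := HV _ Hh; have Hyh := HM _ _ Hy Hh.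
by rewrite /conjg rhoM // mxtrace_mulC -rhoM // mulgK.
Qed.

Lemma representationS (R : realType) (G : topologicalGroupType)
    (H K : set G) n (rho : G -> 'M[CC R]_n) :
  H `<=` K -> representation K rho -> representation H rho.
Proof.
move=> HK /representationP[rho1 rhoM rhoC]; apply/representationP; split=> //.
  by move=> a b Ha Hb; apply: rhoM; apply: HK.
exact: continuous_subspaceW rhoC.
Qed.

(** Serves both for a stable subspace with basis [B] and for a quotient with projection [L]; in
    either case stability gives the last hypothesis. *)
Lemma representation_compress (R : realType) (G : topologicalGroupType)
    (H K : set G) n m (rho : G -> 'M[CC R]_n) (L : 'M[CC R]_(m, n))
    (B : 'M[CC R]_(n, m)) :
  H `<=` K -> representation K rho -> L *m B = 1%:M ->
  (forall a b, H a -> H b ->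
     L *m (rho a *m rho b) *m B = (L *m rho a *m B) *m (L *m rho b *m B)) ->
  representation H (fun g => L *m rho g *m B).
Proof.
move=> HK /representationP[rho1 rhoM rhoC] LB LBM; apply/representationP.
split; first by rewrite rho1 mulmx1.
  by move=> a b Ha Hb; rewrite rhoM ?LBM //; apply: HK.
exact: continuous_mulmx_subspace rhoC.
Qed.

Section Cyclic.
Variables (R : realType) (G : topologicalGroupType) (N : set G).
Hypothesis Nnormal : normal_subgroup N.

Let N1 : N 1%g. Proof. by have [/subgroupP[]] := Nnormal. Qed.
Let NM a b : N a -> N b -> N (a * b)%g.
Proof. by have [/subgroupP[]] := Nnormal; auto. Qed.
Let NV a : N a -> N a^-1%g. Proof. by have [/subgroupP[]] := Nnormal; auto. Qed.
Let NJ a b : N a -> N (a ^ b)%g. Proof. by have [_] := Nnormal; apply. Qed.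

Lemma powers_mul_subgroup x e : (0 < e)%N -> N (x ^+ e)%g -> subgroup (powers_mul N x).
Proof.
move=> e0 xe; apply/subgroupP; split=> [|a b|a].
- exact: powers_mul_sub.
- exact: powers_mulM.
- exact: powers_mulV e0 xe.
Qed.

Lemma cyclic_preimage_powers x e : (0 < e)%N -> N (x ^+ e)%g ->
  cyclic_preimage N (powers_mul N x).
Proof.
move=> e0 xe; exists x; rewrite predeqE => y.
have cosetP a b : left_coset a N = left_coset b N -> exists2 n, N n & b = (a * n)%g.
  move=> ab; have : left_coset b N b by exists 1%g; rewrite ?mulg1.
  by rewrite -ab => -[n Nn <-]; exists n.
split=> [[i [g [Ng ->]]]|[[k _ /cosetP[n Nn ->]]|[k _ /cosetP[n Nn ->]]]].
- left; exists i => //; rewrite predeqE => z; split=> [[n Nn <-]|[n Nn <-]].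
    by exists (g^-1 * n)%g; [apply/NM/Nn/NV|rewrite -mulgA mulVKg].
  by exists (g * n)%g; [exact: NM|rewrite mulgA].
- by exists k, n.
- apply: powers_mulM => //; last exact: powers_mul_sub.
  by apply: (powers_mulV N1 NM NV NJ e0 xe); apply: powers_mulX.
Qed.

(* An induced character vanishes on the generating coset x N, so all the traces
   tr (sigma x sigma g), g in N, would vanish; by Burnside sigma x = 0. *)
Lemma not_induced x e n (sigma : G -> 'M[CC R]_n) (chi : G -> CC R) (H : set G) :
  (0 < e)%N -> N (x ^+ e)%g ->
  representation (powers_mul N x) sigma -> irreducible N sigma ->
  affords (powers_mul N x) sigma chi ->
  subgroup H -> N `<=` H -> H `<` powers_mul N x ->
  ~ induced_from H (powers_mul N x) chi.
Proof.
move=> e0 xe repsigma simp aff /subgroupP[H1 HM HV] NH [HK KH] [psi [_ chiE]].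
have /representationP[sigma1 sigmaM _] := repsigma.
have Kx : powers_mul N x x by exists 1%N, 1%g; rewrite mulg1.
have nHx : ~ H x.
  move=> Hx; apply: KH => _ [i [g [Ng ->]]]; apply: (HM); last exact: NH.
  elim: i => [|i IH]; first by rewrite expg0.
  by rewrite expgS; apply: HM.
have sigmax : sigma x = 0.
  apply: (simple_trace_eq0 (H := N) (rho := sigma)) => // [|g h Ng Nh|g Ng].
  - by exists 1%g.
  - by exists (g * h)%g; [exact: NM|apply: sigmaM; exact: powers_mul_sub].
  have Kg : powers_mul N x g by exact: powers_mul_sub.
  rewrite -sigmaM // -aff ?chiE; try exact: powers_mulM.
  apply: fsbig1 => _ [t Kt <-].
  have : left_coset t H (xget 1%g (left_coset t H)).
    by apply: (@xgetI _ _ _ t); exists 1%g; rewrite ?mulg1.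
  move=> [h Hh <-]; have [i [n' [Nn ->]]] : powers_mul N x (t * h)%g.
    by apply: powers_mulM => //; apply: HK.
  rewrite patchE asboolF // => Hc; apply: nHx.
  (* Conjugation by an element of [<x>N] keeps [x * g] in the coset [xN], so a conjugate in [H]
     would put [x] in [H]. *)
  have xc : ((x * g) ^ (x ^+ i * n') = x * ((n'^-1) ^ x * (g ^ (x ^+ i) * n')))%g.
    rewrite conjgM (conjMg x g).
    have -> : (x ^ (x ^+ i))%g = x.
      by rewrite /conjg (commuteX i (commute_refl x)) mulKg.
    by rewrite /conjg !mulgA mulgV mul1g.
  rewrite -(mulgK ((n'^-1) ^ x * (g ^ (x ^+ i) * n'))%g x) -xc.
  apply: HM => //; apply/HV/NH; apply: NM; first exact/NJ/NV.
  by apply: NM => //; apply: NJ.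
have [n0 _] := simp.
have : sigma x^-1%g *m sigma x = 1%:M.
  by rewrite -sigmaM ?mulVg //; apply: (powers_mulV N1 NM NV NJ e0 xe).
rewrite sigmax mulmx0 => /matrixP/(_ (Ordinal n0) (Ordinal n0)).
by rewrite !mxE eqxx => /eqP; rewrite eq_sym oner_eq0.
Qed.

End Cyclic.

(** The factor [coset_count] cancels the normalisation of induction, and [#|I|] is the index of [N].
    The weights of the [K j] containing a given conjugate of [g] sum to 1, so each of the [#|I|]
    conjugates contributes [chi g]. *)
Lemma artin_formula (R : realType) (G : topologicalGroupType) (N : set G)
    (I : finType) (rep : I -> G) (cls : G -> I) (K : I -> set G)
    (chi : G -> CC R) (a : I -> rat) :
  normal_subgroup N -> cancel rep cls ->
  (forall a b, cls a = cls b <-> N (a^-1 * b)%g) ->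
  (forall j, subgroup (K j)) -> (forall j, N `<=` K j) ->
  class_function [set: G] chi ->
  (forall i, \sum_(j | `[< K j (rep i) >]) a j = 1) ->
  forall g, chi g = \sum_j ratr (a j * (coset_count rep (K j))%:R / #|I|%:R) *
    Ind (K j) [set: G] chi g.
Proof.
move=> Nnormal repK clsE subK NK chiC aP g.
have chiK j : class_function (K j) chi by move=> y h _ _; apply: chiC.
have I0 : (#|I|%:R : CC R) != 0.
  by rewrite pnatr_eq0 -lt0n; apply/card_gt0P; exists (cls 1%g).
(* The weights are controlled at representatives only, but membership in [K j] depends only on the
   coset of [N]. *)
have KE j i : K j (rep (cls (g ^ rep i)%g)) = K j (g ^ rep i)%g.
  have Nc : N ((g ^ rep i)^-1 * rep (cls (g ^ rep i)))%g by apply/clsE; rewrite repK.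
  rewrite -(mulVKg (g ^ rep i)%g (rep _)).
  exact/propext/(subgroup_mulr (subK j))/NK.
have cancel_weight (b c n S : CC R) : c != 0 -> n != 0 ->
    n * (b * c / n * (c^-1 * S)) = b * S.
  by move=> c0 n0; rewrite mulrA [n * _]mulrC divfK // -mulrA mulVKf.
apply: (mulfI I0); rewrite mulr_sumr.
transitivity (\sum_j (ratr (a j) : CC R) *
    \sum_i if `[< K j (g ^ rep i)%g >] then chi (g ^ rep i)%g else 0); last first.
  apply: eq_bigr => j _; rewrite (Ind_setT Nnormal repK clsE) //.
  rewrite !rmorphM fmorphV /= !ratr_nat cancel_weight //.
  exact: (coset_count_neq0 R Nnormal repK clsE (subK j) (NK j)).
under eq_bigr do rewrite mulr_sumr.
rewrite exchange_big mulr_natl -sumr_const; apply: eq_bigr => i _.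
rewrite -{1}(chiC g (rep i)) // -[LHS]mul1r -[X in X * _](rmorph1 (ratr : rat -> CC R)).
rewrite -(aP (cls (g ^ rep i)%g)) rmorph_sum mulr_suml big_mkcond.
apply: eq_bigr => j _; rewrite KE.
by case: asboolP; rewrite ?mulr0.
Qed.

(** Strong induction on the dimension, splitting off the span of the translates. The second group of
    clauses on [H l] is what transitivity of induction asks for. *)
Lemma cyclic_character_decomposition (R : realType) (G : topologicalGroupType)
    (N : set G) (I : finType) (rep : I -> G) (cls : G -> I) (x : G) e n
    (rho : G -> 'M[CC R]_n) :
  normal_subgroup N -> cancel rep cls ->
  (forall a b, cls a = cls b <-> N (a^-1 * b)%g) ->
  (0 < e)%N -> N (x ^+ e)%g -> representation (powers_mul N x) rho ->
  exists (m : nat) (H : 'I_m -> set G) (psi : 'I_m -> G -> CC R),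
    (forall l, [/\ cyclic_preimage N (H l),
       irreducible_character (H l) (psi l),
       forall H' : set G, subgroup H' -> N `<=` H' -> H' `<` H l ->
         ~ induced_from H' (H l) (psi l)
     & irreducible_character N (psi l)] /\
     [/\ subgroup (H l), N `<=` H l, H l `<=` powers_mul N x &
       class_function (H l) (psi l)]) /\
    forall g, powers_mul N x g ->
      \tr (rho g) = \sum_l Ind (H l) (powers_mul N x) (psi l) g.
Proof.
move=> Nnormal repK clsE e0 xe.
have [/subgroupP[N1 NM NV] NJ] := Nnormal.
set K := powers_mul N x.
have subK : subgroup K := powers_mul_subgroup Nnormal e0 xe.
elim/ltn_ind: n rho => n IH rho reprho.
case: (posnP n) => [n0|n0].
  subst n; exists 0%N, (fun=> set0), (fun=> fun=> 0); split=> [[]//|g Kg].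
  by rewrite big_ord0 /mxtrace big_ord0.
have /representationP[rho1 rhoM rhoC] := reprho.
have [k [d [B [L [k0 LB simp rhoB twist]]]]] :=
  stable_cyclic_simple N1 NM NV NJ e0 xe n0 rho1 rhoM.
pose sigma g := L *m rho g *m B.
have [Lk LBk] := translates_independent N1 NM NV NJ e0 xe rho1 rhoM LB simp rhoB twist.
set Bk := mxrow _ in LBk.
pose H := powers_mul N (x ^+ k)%g.
have HK : H `<=` K by move=> h; apply: powers_mulXX.
have NH : N `<=` H by move=> h; apply: powers_mul_sub.
have xke : N ((x ^+ k) ^+ e)%g by apply: powers_mul_exp.
have subH : subgroup H := powers_mul_subgroup Nnormal e0 xke.
have repsigma : representation H sigma.
  apply: (representation_compress HK reprho LB) => a b Ha Hb.
  by rewrite (mulmxA L) -(mulmxA (L *m rho a) (rho b)) (rhoB b Hb) !mulmxA.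
pose psi g := \tr (sigma g).
have psiC : class_function H psi := representation_class_function subH repsigma.
have psi_char : [/\ cyclic_preimage N H, irreducible_character H psi,
   forall H' : set G, subgroup H' -> N `<=` H' -> H' `<` H -> ~ induced_from H' H psi
   & irreducible_character N psi].
  split.
  - exact: cyclic_preimage_powers e0 xke.
  - exists d, sigma; split=> //; split=> [|W Wst]; first exact: simp.1.
    by apply: simp.2 => h v Nh; apply: Wst; apply: NH.
  - move=> H' subH' NH' ltH'.
    by apply: (not_induced Nnormal e0 xke repsigma simp _ subH' NH' ltH').
  - by exists d, sigma; split=> //; apply: representationS repsigma.
pose phi := patch (fun=> 0) H psi.
have phiE h : H h -> phi h = psi h by move=> Hh; rewrite /phi patchE asboolT.
have phi0 h : ~ H h -> phi h = 0 by move=> Hh; rewrite /phi patchE asboolF.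
have trBk g : K g -> rho g *m Bk = Bk *m (Lk *m rho g *m Bk) /\
    \tr (Lk *m rho g *m Bk) = Ind H K psi g.
  move=> Kg; have [E1 E2] := translates_trace N1 NM NV NJ e0 xe rho1 rhoM k0 LB
    rhoB twist (phi := phi) LBk Kg
    phiE phi0.
  split=> //; rewrite E2.
  rewrite (Ind_transversal Nnormal repK clsE subH NH g HK subK psiC
    (t := fun i : 'I_k => (x ^+ i)%g)) //.
  - by move=> i; apply: powers_mulX.
  - by move=> a Ka; apply: powers_mul_transversal.
  - exact: (transversal_inj N1 NM NV NJ e0 xe rho1 rhoM LB rhoB twist).
have [L' [C [LB' LC' BLC]]] := split_quotient LBk.
have repquo : representation K (fun g => L' *m rho g *m C).
  apply: (representation_compress _ reprho LC') => // a b Ka Kb.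
  have L'a : L' *m rho a *m Bk = 0.
    by rewrite -mulmxA (trBk a Ka).1 (mulmxA L') LB' mul0mx.
  (* [L' *m rho a] kills the columns of [Bk], so it factors through [L']; this makes the quotient
     action multiplicative. *)
  have L'E : L' *m rho a = L' *m rho a *m C *m L'.
    rewrite -[LHS]mulmx1 -BLC mulmxDr (mulmxA _ Bk) L'a mul0mx add0r.
    by rewrite (mulmxA _ C).
  by rewrite (mulmxA L') {1}L'E !mulmxA.
have lt_dim : (n - \sum_(i < k) d < n)%N.
  by rewrite sum_nat_const card_ord ltn_subrL n0 andbT muln_gt0 k0 simp.1.
have [m [H' [psi' [psi'P trE]]]] := IH _ lt_dim _ repquo.
(* Index 0 carries [H] and [psi]; the others are those of the quotient, shifted by one. *)
exists m.+1, (fun l => oapp H' H (unlift ord0 l)),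
  (fun l => oapp psi' psi (unlift ord0 l)).
split=> [l|g Kg].
  by case: unliftP => [j _|_] //=; apply: psi'P.
rewrite (trace_split (rho g) BLC) (trBk g Kg).2 trE // big_ord_recl unlift_none /=.
by under [in RHS]eq_bigr do rewrite liftK.
Qed.

Theorem lemma10p18 (R : realType) (G : topologicalGroupType) (G0 : set G)
    (G_compact : compact [set: G])
    (G0_normal : normal_subgroup G0) (G0_open : open G0)
    (chi : G -> CC R) (chi_char : character [set: G] chi) :
  exists (m : nat) (q : 'I_m -> rat)
         (G1 : 'I_m -> set G) (chi1 : 'I_m -> G -> CC R),
    (forall j : 'I_m,
      [/\ cyclic_preimage G0 (G1 j),
          irreducible_character (G1 j) (chi1 j),
          forall H : set G, subgroup H -> G0 `<=` H -> H `<` G1 j ->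
            ~ induced_from H (G1 j) (chi1 j)
        & irreducible_character G0 (chi1 j)]) /\
    forall g : G,
      chi g = \sum_(j < m) ratr (q j) * Ind (G1 j) [set: G] (chi1 j) g.
Proof.
have [/subgroupP[N1 NM NV] NJ] := G0_normal.
have [I [rep [cls [repK clsE]]]] := compact_transversal G_compact G0_open N1 NM NV.
have [n [rho [reprho aff]]] := chi_char.
have chiE g : chi g = \tr (rho g) by rewrite aff.
have chiC : class_function [set: G] chi.
  have subT : subgroup [set: G] by apply/subgroupP.
  have := representation_class_function subT reprho.
  by move=> trC y h _ _; rewrite !chiE trC.
(* Pigeonhole: two of the first [#|I|.+1] powers of [x] lie in the same coset of [G0]. *)
have expo x : exists2 e, (0 < e)%N & G0 (x ^+ e)%g.
  have /injectivePn[i [j ij /clsE]] :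
      ~~ injectiveb (fun i : 'I_#|I|.+1 => cls (x ^+ i)%g).
    by apply/negP => /injectiveP /leq_card; rewrite card_ord ltnn.
  have diff a b : (a < b)%N -> ((x ^+ a)^-1 * x ^+ b = x ^+ (b - a))%g.
    by move=> ab; rewrite -{1}(subnKC (ltnW ab)) expgnDr mulKg.
  case: (ltngtP i j) => [lt_ij|lt_ji|/val_inj eq_ij] Nij; last first.
  - by rewrite eq_ij eqxx in ij.
  - exists (i - j)%N; rewrite ?subn_gt0 // -diff //.
    by have := NV _ Nij; rewrite invgM invgK.
  by exists (j - i)%N; rewrite ?subn_gt0 // -diff.
(* A cyclic subgroup of [G/G0] occurs once for each of its generators, so inclusion is only a
   preorder on the indices. *)
pose K j := powers_mul G0 (rep j).
have subK j : subgroup (K j).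
  by have [e e0 xe] := expo (rep j); apply: powers_mul_subgroup xe.
have NK j : G0 `<=` K j by move=> g; apply: powers_mul_sub.
have [a aP] : exists a : I -> rat, forall i, \sum_(j | `[< K j (rep i) >]) a j = 1.
  apply: (preorder_weights (le := fun i j => `[< K j (rep i) >])) => [i|j i l].
    by apply/asboolP; exists 1%N, 1%g; rewrite mulg1.
  move=> /asboolP[b [g [Ng ijE]]] /asboolP Kj; apply/asboolP; rewrite /= ijE.
  have /subgroupP[K1 KM KV] := subK l; apply: (KM); last exact: NK.
  elim: b {ijE} => [|b IHb]; first by rewrite expg0.
  by rewrite expgS; apply: KM.
have chiA := artin_formula G0_normal repK clsE subK NK chiC aP.
pose c j := a j * (coset_count rep (K j))%:R / #|I|%:R.
have decomp j : exists (m : nat) (H : 'I_m -> set G) (psi : 'I_m -> G -> CC R),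
    (forall l, [/\ cyclic_preimage G0 (H l),
       irreducible_character (H l) (psi l),
       forall H' : set G, subgroup H' -> G0 `<=` H' -> H' `<` H l ->
         ~ induced_from H' (H l) (psi l)
     & irreducible_character G0 (psi l)]) /\
    forall g, Ind (K j) [set: G] chi g = \sum_l Ind (H l) [set: G] (psi l) g.
  have [e e0 xe] := expo (rep j).
  have [m [H [psi [HP trE]]]] := cyclic_character_decomposition G0_normal repK
    clsE e0 xe (representationS (@subsetT _ (K j)) reprho).
  exists m, H, psi; split=> [l|g]; first by have [] := HP l.
  (* The coefficients are 1 at this stage; the rational ones come from Artin's formula. *)
  have -> := Ind_trans G0_normal repK clsE (q := fun=> 1) (f := chi) (subK j)
    (NK j) _ (fun l => (HP l).2).
  - by apply: eq_bigr => l _; rewrite rmorph1 mul1r.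
  - by move=> y h _ _; apply: chiC.
  - move=> y Ky; rewrite chiE trE //; apply: eq_bigr => l _.
    by rewrite rmorph1 mul1r.
have [m /fin_all_exists[H /fin_all_exists[psi decP]]] := fin_all_exists decomp.
pose T : finType := {j : I & 'I_(m j)}.
exists #|{: T}|, (fun i => c (tag (enum_val i))),
  (fun i => H _ (tagged (enum_val i))), (fun i => psi _ (tagged (enum_val i))).
split=> [i|g]; first exact: (decP (tag (enum_val i))).1.
pose F (t : T) := ratr (c (tag t)) * Ind (H _ (tagged t)) [set: G] (psi _ (tagged t)) g.
transitivity (\sum_(t in {: T}) F t); last by rewrite big_enum_val.
rewrite chiA.
transitivity (\sum_j \sum_(l : 'I_(m j)) ratr (c j) * Ind (H j l) [set: G] (psi j l) g).
  by apply: eq_bigr => j _; rewrite (decP j).2 mulr_sumr.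
by rewrite sig_big_dep.
Qed.
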